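(* Let $G$ be a finite group with normal subgroups $N\leq M$. Suppose $\mathcal C=(\mathcal X,\mathcal K)$ is a $G$-invariant supercharacter theory of $M$ and $\mathcal D=(\mathcal Y,\mathcal L)$ is a supercharacter theory of $G/N$ such that 1. $N$ is $\mathcal C$-normal, 2. $M/N$ is $\mathcal D$-normal, and 3. $\mathcal C^{M/N}=\mathcal D_{M/N}$. Then there exists a unique supercharacter theory $\mathcal E$ of $G$ such that $\mathcal E_M=\mathcal C$ and $\mathcal E^{G/N}=\mathcal D$ and every superclass of $\mathcal E$ outside $M$ is a union of $N$-cosets. Moreover, $$\mathcal E=\left(\mathcal Y\cup\{X^G: X\in\mathcal X,\ X\not\subseteq\mathrm{Irr}(M/N)\},\ \ \mathcal K\cup\{\widetilde L: L\in\mathcal L,\ L\not\subseteq M/N\}\right).$$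
   Context: $\mathrm{Irr}(G)$ is the set of complex irreducible characters of $G$. A supercharacter theory of $G$ is a pair $(\mathcal X,\mathcal K)$, with $\mathcal X$ a partition of $\mathrm{Irr}(G)$ and $\mathcal K$ a partition of $G$, such that $|\mathcal X|=|\mathcal K|$ and for every $X\in\mathcal X$ there is a character $\chi_X$ of $G$ whose irreducible constituents lie in $X$, with each $\chi_X$ constant on every part $K\in\mathcal K$, and every irreducible character of $G$ a constituent of some $\chi_X$. (It is known, by Diaconis and Isaacs, that $\chi_X$ is then a constant multiple of $\sigma_X=\sum_{\psi\in X}\psi(1)\psi$, one always takes $\chi_X=\sigma_X$, and each of $\mathcal X$, $\mathcal K$ determines the other.) The members of $\mathcal K$ are the superclasses. A supercharacter theory of a normal subgroup $M$ of $G$ is $G$-invariant if conjugation by $G$ fixes each of its superclasses setwise. If $\mathcal E$ is a supercharacter theory of $G$, a subgroup of $G$ is $\mathcal E$-normal if it is a union of superclasses of $\mathcal E$ (such a subgroup is normal in $G$). If $H$ is $\mathcal E$-normal, then $\mathcal E_H$ denotes the (unique, existing) supercharacter theory of $H$ whose superclasses are exactly the superclasses of $\mathcal E$ contained in $H$, and $\mathcal E^{G/H}$ denotes the (unique, existing) supercharacter theory of $G/H$ whose partition of $\mathrm{Irr}(G/H)$ consists of exactly the parts of the character partition of $\mathcal E$ contained in $\mathrm{Irr}(G/H)$, where $\mathrm{Irr}(G/H)$ is identified with $\{\chi\in\mathrm{Irr}(G):H\subseteq\ker\chi\}$. (The condition $\mathcal E_M=\mathcal C$ includes that $M$ is $\mathcal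 E$-normal, and $\mathcal E^{G/N}=\mathcal D$ includes that $N$ is $\mathcal E$-normal.) For a $G$-invariant subset $X\subseteq\mathrm{Irr}(M)$, $X^G=\bigcup_{\psi\in X}\mathrm{Irr}(G|\psi)$, where $\mathrm{Irr}(G|\psi)$ is the set of $\chi\in\mathrm{Irr}(G)$ having $\psi$ as a constituent of the restriction $\chi_M$. For $L\subseteq G/N$, $\widetilde L\subseteq G$ is its full preimage. *)

(* Defs.v *)
From mathcomp Require Import all_boot all_order all_fingroup all_algebra.
From mathcomp Require Import all_solvable all_field all_character.

Set Implicit Arguments.
Unset Strict Implicit.
Unset Printing Implicit Defensive.

Local Open Scope ring_scope.
Local Open Scope group_scope.

(* Irreducible characters are represented by their indices in Iirr G. *)
Definition sct_pair (gT : finGroupType) (G : {group gT}) : Type :=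
  ({set {set Iirr G}} * {set {set gT}})%type.

Definition supercharacter_theory (gT : finGroupType) (G : {group gT})
    (E : sct_pair G) : Prop :=
  [/\ partition E.1 [set: Iirr G],
      partition E.2 G,
      #|E.1| = #|E.2|
    & exists chi : {set Iirr G} -> 'CF(G),
        [/\ forall X, X \in E.1 ->
              chi X \is a character /\ {subset irr_constt (chi X) <= X},
            forall X K, X \in E.1 -> K \in E.2 ->
              {in K &, forall x y, chi X x = chi X y}
          & forall i : Iirr G,
              exists2 X, X \in E.1 & i \in irr_constt (chi X)]].

Definition sct_invariant (gT : finGroupType) (G M : {group gT})
    (C : sct_pair M) : Prop :=
  forall K g, K \in C.2 -> g \in G -> K :^ g = K.

Definition sct_normal (gT : finGroupType) (G : {group gT}) (E : sct_pair G)
    (H : {group gT}) : Prop :=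
  exists2 S : {set {set gT}}, S \subset E.2 & cover S = H.

(* Irr(G/H), seen as a subset of Irr(G). *)
Definition Irr_quo (gT : finGroupType) (G H : {group gT}) : {set Iirr G} :=
  [set i : Iirr G | H \subset cfker 'chi_i].

(* Inflation along G -> G/H, applied to every set of a family of subsets of
   Irr(G/H); this is the identification of Irr(G/H) with Irr_quo G H. *)
Definition infl (gT : finGroupType) (G H : {group gT})
    (Y : {set {set Iirr (G / H)%G}}) : {set {set Iirr G}} :=
  [set [set @mod_Iirr gT G H i | i in B] | B : {set Iirr (G / H)%G} in Y].

(* E_H = F.  The theory E_H is determined by its superclasses, so it is given
   as a relation. *)
Definition sct_sub (gT : finGroupType) (G : {group gT}) (E : sct_pair G)
    (H : {group gT}) (F : sct_pair H) : Prop :=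
  [/\ sct_normal E H, supercharacter_theory F
    & F.2 = [set K in E.2 | K \subset H]].

(* E^(G/H) = F.  The theory E^(G/H) is determined by its partition of
   Irr(G/H). *)
Definition sct_quo (gT : finGroupType) (G : {group gT}) (E : sct_pair G)
    (H : {group gT}) (F : sct_pair (G / H)%G) : Prop :=
  [/\ sct_normal E H, supercharacter_theory F
    & infl F.1 = [set X in E.1 | X \subset Irr_quo G H]].

Definition Irr_over (gT : finGroupType) (G M : {group gT}) (X : {set Iirr M}) :
    {set Iirr G} :=
  [set j : Iirr G | [exists i in X, i \in irr_constt ('Res[M] 'chi_j)]].

Definition union_of_cosets (gT : finGroupType) (G N : {group gT})
    (K : {set gT}) : Prop :=
  exists2 T : {set {set gT}}, T \subset rcosets N G & cover T = K.

Definition sct_product (gT : finGroupType) (G M N : {group gT})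
    (C : sct_pair M) (D : sct_pair (G / N)%G) : sct_pair G :=
  (infl D.1 :|:
     [set Irr_over G X | X : {set Iirr M} in C.1 & ~~ (X \subset Irr_quo M N)],
   C.2 :|:
     [set coset N @*^-1 L |
        L : {set coset_of N} in D.2 & ~~ (L \subset M / N)]).

(* Main.v *)
(* For a supercharacter theory E of G, the characters sigma X (the sums of
   chi(1) chi over the parts X of Irr(G)) form a basis of the functions constant
   on superclasses.  A class function phi is therefore constant on superclasses
   iff [phi, chi] / chi(1) depends only on the part containing chi; this makes
   each partition determine the other and behaves well under inflation.

   For the product of C and D, sigma of an inflated part is the inflation of a
   sigma of D, and on M condition 3 makes it constant on the superclasses of C.
   By Clifford's theorem sigma (X^G) is Ind sigma X, which vanishes off M and is
   |G : M| sigma X on M. *)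
Require Import Defs.
From mathcomp Require Import all_boot all_order all_fingroup all_algebra.
From mathcomp Require Import all_solvable all_field all_character.

Set Implicit Arguments.
Unset Strict Implicit.
Unset Printing Implicit Defensive.

Import GRing.Theory Num.Theory.

Local Open Scope ring_scope.
Local Open Scope group_scope.

(** * Partitions of finite sets *)

Section Partitions.

Variable T : finType.
Implicit Types (P Q : {set {set T}}) (D : {set T}).

Lemma partition_ex P D x : partition P D -> x \in D ->
  exists2 A, A \in P & x \in A.
Proof. by case/and3P=> /eqP <- _ _ /bigcupP[A PA Ax]; exists A. Qed.

Lemma partition_eq_mem P D A B x : partition P D ->
  A \in P -> B \in P -> x \in A -> x \in B -> A = B.
Proof.
case/and3P=> _ tiP _ PA PB Ax Bx.
by rewrite -(def_pblock tiP PA Ax) (def_pblock tiP PB Bx).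
Qed.

Lemma partition_in P D A x :
  partition P D -> A \in P -> x \in A -> x \in D.
Proof. by move=> pP PA; apply/subsetP: x; apply: partitionS pP PA. Qed.

Lemma partition_intro P D :
    (forall A, A \in P -> A != set0) -> (forall A, A \in P -> A \subset D) ->
    (forall x, x \in D -> exists2 A, A \in P & x \in A) ->
    (forall A B x, A \in P -> B \in P -> x \in A -> x \in B -> A = B) ->
  partition P D.
Proof.
move=> P0 PS Pex Pun; apply/and3P; split.
- rewrite eqEsubset; apply/andP; split; first exact/bigcupsP.
  by apply/subsetP=> x /Pex[A PA Ax]; apply/bigcupP; exists A.
- apply/trivIsetP=> A B PA PB; apply: contraR => /pred0Pn[x /andP[/= Ax Bx]].
  by apply/eqP; apply: Pun Ax Bx.
- by apply/negP=> /P0/eqP.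
Qed.

(** Each block of [P] is nonempty, so it meets a block of [Q], and the hypothesis makes the two
    equal. *)
Lemma partition_refine_sub P Q D : partition P D -> partition Q D ->
    (forall A B x y, A \in P -> B \in Q -> x \in A -> x \in B ->
       (y \in A) = (y \in B)) ->
  P \subset Q.
Proof.
move=> pP pQ eqPQ; apply/subsetP=> A PA.
have /set0Pn[x Ax] := partition_neq0 pP PA.
have [B QB Bx] := partition_ex pQ (partition_in pP PA Ax).
by rewrite (_ : A = B) //; apply/setP=> y; apply: eqPQ Ax Bx.
Qed.

Lemma partition_eq P Q D : partition P D -> partition Q D ->
    (forall A B x y, A \in P -> B \in Q -> x \in A -> x \in B ->
       (y \in A) = (y \in B)) ->
  P = Q.
Proof.
move=> pP pQ eqPQ; apply/eqP; rewrite eqEsubset.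
rewrite (partition_refine_sub pP pQ) //=.
by apply: (partition_refine_sub pQ pP) => A B x y ? ? ? ?; apply/esym/(eqPQ B A x).
Qed.

End Partitions.

(** * Functions constant on superclasses and their irreducible coefficients *)

Section Sigma.

Variables (gT : finGroupType) (G : {group gT}).
Implicit Types (X : {set Iirr G}) (E : sct_pair G).

Definition sigma X : 'CF(G) := (\sum_(i in X) 'chi_i 1%g *: 'chi_i)%R.

Lemma cfdot_sigma X i :
  ('[sigma X, 'chi_i] = if i \in X then 'chi_i 1%g else 0)%R.
Proof.
rewrite cfdot_suml; case: ifP => Xi.
  rewrite (bigD1 i) //= big1 => [|j /andP[_ /negbTE ji]].
    by rewrite cfdotZl cfdot_irr eqxx mulr1 addr0.
  by rewrite cfdotZl cfdot_irr ji mulr0.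
rewrite big1 // => j Xj; rewrite cfdotZl cfdot_irr.
by case: eqP => [ji|_]; [rewrite -ji Xj in Xi | rewrite mulr0].
Qed.

Lemma sigma_char X : sigma X \is a character.
Proof.
apply: rpred_sum => i _; have /natrP[n ->] := Cnat_irr1 i.
by rewrite scaler_nat rpredMn ?irr_char.
Qed.

Lemma irr_constt_sigma X i : (i \in irr_constt (sigma X)) = (i \in X).
Proof. by rewrite irr_consttE cfdot_sigma; case: ifP; rewrite ?irr1_neq0 ?eqxx. Qed.

Definition cf_const (P : {set {set gT}}) (phi : 'CF(G)) :=
  forall K, K \in P -> {in K &, forall x y, phi x = phi y}.

(* Equivalently, phi is a linear combination of the [sigma X], X in P. *)
Definition cf_bal (P : {set {set Iirr G}}) (phi : 'CF(G)) :=
  forall X, X \in P -> {in X &, forall i j,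
    '[phi, 'chi_i] / 'chi_i 1%g = '[phi, 'chi_j] / 'chi_j 1%g}%R.

Lemma sct_intro E : partition E.1 [set: Iirr G] -> partition E.2 G ->
    #|E.1| = #|E.2| -> (forall X, X \in E.1 -> cf_const E.2 (sigma X)) ->
  supercharacter_theory E.
Proof.
move=> pX pK eqXK cX; split=> //; exists sigma; split=> [X _|X K /cX cXK /cXK //|i].
  by split; [apply: sigma_char | move=> i; rewrite irr_constt_sigma].
have [X EX Xi] := partition_ex pX (in_setT i).
by exists X; rewrite ?irr_constt_sigma.
Qed.

(** The [chi X] have disjoint sets of constituents, hence are linearly independent, and there are as
    many of them as superclasses. So the square matrix of their values is invertible. Taking for [f]
    an arbitrary function on [gT] lets this result produce class functions. *)
Lemma sct_span E (chi : {set Iirr G} -> 'CF(G)) :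
    partition E.1 [set: Iirr G] -> partition E.2 G -> #|E.1| = #|E.2| ->
    (forall X i, X \in E.1 -> (i \in irr_constt (chi X)) = (i \in X)) ->
    (forall X, X \in E.1 -> cf_const E.2 (chi X)) ->
  forall f : gT -> algC, (forall K, K \in E.2 -> {in K &, forall x y, f x = f y}) ->
  exists a : {set Iirr G} -> algC,
    {in G, forall x, f x = \sum_(X in E.1) a X * chi X x}%R.
Proof.
case: E => P Q /= pP pQ eqPQ cP cQ f cf.
have ltr K : K \in Q -> repr K \in K.
  by move/(partition_neq0 pQ)=> /set0Pn[x]; apply: mem_repr.
pose kk (j : 'I_#|P|) : {set gT} := enum_val (cast_ord eqPQ j).
have kkQ j : kk j \in Q by apply: enum_valP.
have kkE K : K \in Q -> exists j, kk j = K.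
  move=> QK; exists (cast_ord (esym eqPQ) (enum_rank_in QK K)).
  by rewrite /kk cast_ordKV enum_rankK_in.
pose A := (\matrix_(i < #|P|, j < #|P|) chi (enum_val i) (repr (kk j)))%R.
have sumE (u : 'rV[algC]_#|P|) K x : K \in Q -> x \in K ->
    exists j, (kk j = K /\ (u *m A) 0 j = \sum_i u 0 i * chi (enum_val i) x)%R.
  move=> QK Kx; have [j jK] := kkE K QK; exists j; split=> //.
  rewrite mxE; apply: eq_bigr => i _; rewrite mxE jK; congr (_ * _)%R.
  by apply: (cQ _ (enum_valP i) K) => //; apply: ltr.
have freeA : row_free A.
  (* A row vector killed by [A] gives a combination of the [chi X] vanishing on every superclass.
     Pairing it with an irreducible character [k] of the [i]-th part leaves only the term of
     [u 0 i]. *)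
  apply/inj_row_free => u uA0; apply/rowP=> i; rewrite mxE.
  have sum0 : (\sum_i u 0 i *: chi (enum_val i) = 0 :> 'CF(G))%R.
    apply/cfun_inP=> x Gx; rewrite sum_cfunE cfunE.
    have [K QK Kx] := partition_ex pQ Gx.
    have [j [_ uAj]] := sumE u K x QK Kx.
    transitivity ((u *m A) 0 j)%R; last by rewrite uA0 mxE.
    by rewrite uAj; apply: eq_bigr => k _; rewrite cfunE.
  have /set0Pn[k Xk] := partition_neq0 pP (enum_valP i).
  move/(congr1 (fun phi : 'CF(G) => '[phi, 'chi_k]%R)): sum0.
  rewrite cfdot0l cfdot_suml (bigD1 i) //= big1 => [|j ji]; last first.
    rewrite cfdotZl; have [|/negbNE/eqP->] := boolP (k \in irr_constt (chi (enum_val j))).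
      rewrite cP ?enum_valP // => Xjk; case/eqP: ji; apply: enum_val_inj.
      by apply: partition_eq_mem pP _ _ Xjk Xk; apply: enum_valP.
    by rewrite mulr0.
  rewrite addr0 cfdotZl => /eqP; rewrite mulf_eq0 => /orP[/eqP //|].
  by have := cP _ k (enum_valP i); rewrite irr_consttE Xk => /negPf->.
pose v := (\row_j f (repr (kk j)))%R.
pose u := (v *m invmx A)%R.
have uA : (u *m A = v)%R by rewrite mulmxKV // -row_free_unit.
(* For a part [X] this sum has a single term; it turns coefficients indexed by ordinals into
   coefficients indexed by sets. *)
exists (fun X => \sum_(i | enum_val i == X) u 0 i)%R => x Gx.
have [K QK Kx] := partition_ex pQ Gx.
have [j [jK uAj]] := sumE u K x QK Kx.
transitivity (v 0 j)%R; first by rewrite mxE jK; apply: (cf K) => //; apply: ltr.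
rewrite -uA uAj [RHS]big_enum_val /=; apply: eq_bigr => i _.
rewrite (big_pred1 i) // => k; apply/eqP/eqP=> [/enum_val_inj // | -> //].
Qed.

(** An [i] in [X] is a constituent of some [chi Y], whose constituents lie in [Y]; as parts are
    disjoint, [Y] is [X]. *)
Lemma sct_chi E : supercharacter_theory E ->
  exists chi : {set Iirr G} -> 'CF(G),
    (forall X i, X \in E.1 -> (i \in irr_constt (chi X)) = (i \in X)) /\
    (forall X, X \in E.1 -> cf_const E.2 (chi X)).
Proof.
case=> pX pK eqXK [chi [chiX chiK chi_ex]]; exists chi; split=> [X i EX|X EX K EK].
  apply/idP/idP=> [|Xi]; first by case: (chiX X EX) => _ /(_ i).
  have [Y EY Yi] := chi_ex i; have [_ /(_ i Yi) Yi'] := chiX Y EY.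
  by rewrite (partition_eq_mem pX EX EY Xi Yi').
exact: chiK.
Qed.

(** The superclass of 1 lies in the kernel of each [chi X], hence of each irreducible character, and
    these kernels intersect trivially. *)
Lemma sct_set1 E : supercharacter_theory E -> [set 1%g] \in E.2.
Proof.
case=> pX pK _ [chi [chiX chiK chi_ex]].
have [K EK K1] := partition_ex pK (group1 G).
suff -> : [set 1%g] = K by [].
apply/setP=> x; rewrite !inE; apply/eqP/idP=> [-> //|Kx].
suff: x \in \bigcap_i cfker 'chi[G]_i by rewrite TI_cfker_irr => /set1P.
apply/bigcapP=> i _.
have [X EX Xi] := chi_ex i; have [chX _] := chiX X EX.
apply: (subsetP (cfker_constt chX Xi)).
rewrite cfkerEchar // inE (partition_in pK EK Kx) /=.
by apply/eqP/(chiK X K).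
Qed.

(** Used to turn indicators of superclasses into class functions. *)
Lemma cf_const_class_fun E (f : gT -> algC) : supercharacter_theory E ->
    (forall K, K \in E.2 -> {in K &, forall x y, f x = f y}) ->
  exists phi : 'CF(G), {in G, phi =1 f}.
Proof.
move=> sE cf; have [chi [cX cK]] := sct_chi sE; case: sE => pX pK eqXK _.
have [a fE] := sct_span pX pK eqXK cX cK cf.
exists (\sum_(X in E.1) a X *: chi X)%R => x Gx.
by rewrite sum_cfunE fE //; apply: eq_bigr => X _; rewrite cfunE.
Qed.

Lemma cf_bal_sum P phi : partition P [set: Iirr G] -> cf_bal P phi ->
  exists a : {set Iirr G} -> algC, (phi = \sum_(X in P) a X *: sigma X)%R.
Proof.
move=> pP bal.
(* The common ratio on [X]; the default 0 concerns only the empty set. *)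
pose a (X : {set Iirr G}) : algC :=
  (if [pick i in X] is Some i then '[phi, 'chi_i] / 'chi_i 1%g else 0)%R.
exists a; rewrite {1}[phi]cfun_sum_cfdot.
transitivity (\sum_(i in [set: Iirr G]) '[phi, 'chi_i] *: 'chi_i)%R.
  by apply: eq_bigl => i; rewrite inE.
rewrite (set_partition_big _ pP) /=; apply: eq_bigr => X PX.
rewrite scaler_sumr; apply: eq_bigr => i Xi; rewrite scalerA; congr (_ *: _)%R.
rewrite /a; case: pickP => [j Xj|/(_ i)]; last by rewrite Xi.
by rewrite (bal X PX j i Xj Xi) divfK ?irr1_neq0.
Qed.

Lemma cf_const_sum (P : {set {set gT}}) (I : finType) (Q : {set I}) (a : I -> algC)
    (F : I -> 'CF(G)) :
    (forall i, i \in Q -> cf_const P (F i)) ->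
  cf_const P (\sum_(i in Q) a i *: F i)%R.
Proof.
move=> cF K PK x y Kx Ky; rewrite !sum_cfunE; apply: eq_bigr => i Qi.
by rewrite !cfunE (cF i Qi K PK x y).
Qed.

(* The indicator of the superclass {1} is a multiple of the regular character,
   and comparing coefficients makes each [chi X] a multiple of [sigma X]. *)
Lemma sct_balP E : supercharacter_theory E ->
  forall phi, cf_const E.2 phi <-> cf_bal E.1 phi.
Proof.
move=> sE; have E1 := sct_set1 sE; have [chi [cX cK]] := sct_chi sE.
case: sE => pX pK eqXK _.
have span phi : cf_const E.2 phi ->
    exists a : {set Iirr G} -> algC, (phi = \sum_(X in E.1) a X *: chi X)%R.
  move=> cphi; have [a aE] := sct_span pX pK eqXK cX cK cphi.
  exists a; apply/cfun_inP=> x Gx; rewrite aE // sum_cfunE.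
  by apply: eq_bigr => X _; rewrite cfunE.
have dotE (a : {set Iirr G} -> algC) X i : X \in E.1 -> i \in X ->
    ('[\sum_(X in E.1) a X *: chi X, 'chi_i] = a X * '[chi X, 'chi_i])%R.
  move=> EX Xi; rewrite cfdot_suml (bigD1 X) //= big1 => [|Y /andP[EY YX]].
    by rewrite cfdotZl addr0.
  rewrite cfdotZl; have [|/negbNE/eqP->] := boolP (i \in irr_constt (chi Y)).
    by rewrite cX // => Yi; case/eqP: YX; apply: partition_eq_mem pX EY EX Yi Xi.
  by rewrite mulr0.
have [a regE] : exists a : {set Iirr G} -> algC,
    (cfReg G = \sum_(X in E.1) a X *: chi X)%R.
  apply: span => K EK x y Kx Ky; rewrite !cfRegE.
  have eqK z : z \in K -> z == 1%g -> K = [set 1%g].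
    by move=> Kz /eqP z1; apply: partition_eq_mem pK EK E1 Kz _; rewrite z1 inE.
  have [x1|] := eqVneq x; have [y1|] := eqVneq y; rewrite // => /eqP[].
    by apply/set1P; rewrite -(eqK x) // x1.
  by apply/set1P; rewrite -(eqK y) // y1.
(* Compares coefficients of the regular character at [i]. As degrees are nonzero, [a X] is nonzero
   too. *)
have chi1E X i : X \in E.1 -> i \in X -> ('chi_i 1%g = a X * '[chi X, 'chi_i])%R.
  move=> EX Xi; rewrite -dotE // -regE cfReg_sum.
  have <- : sigma [set: Iirr G] = (\sum_i 'chi_i 1%g *: 'chi_i)%R.
    by apply: eq_bigl => j; rewrite inE.
  by rewrite cfdot_sigma inE.
have sigE X : X \in E.1 -> sigma X = (a X *: chi X)%R.
  move=> EX; rewrite [sigma X]cfun_sum_cfdot [chi X]cfun_sum_cfdot scaler_sumr.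
  apply: eq_bigr => i _; rewrite scalerA cfdot_sigma; case: ifP => Xi;
    first by rewrite (chi1E X).
  have : i \notin irr_constt (chi X) by rewrite cX // Xi.
  by rewrite irr_consttE negbK => /eqP->; rewrite mulr0.
move=> phi; split=> [/span[b ->] X EX i j Xi Xj | bal].
  have balE k : k \in X -> ('chi_k 1%g != 0 /\
      '[\sum_(X in E.1) b X *: chi X, 'chi_k] / 'chi_k 1%g = b X / a X)%R.
    move=> Xk; have chik := chi1E X k EX Xk; split; first exact: irr1_neq0.
    have := irr1_neq0 k; rewrite (dotE b X) // {}chik mulf_eq0 negb_or => /andP[a0 c0].
    by rewrite invfM mulrACA divff // mulr1.
  by have [_ ->] := balE i Xi; have [_ ->] := balE j Xj.
have [b ->] := cf_bal_sum pX bal; apply: cf_const_sum => X EX K EK x y Kx Ky.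
by rewrite sigE // !cfunE (cK X EX K EK x y).
Qed.

(** The ratio of coefficient to degree is 1 on [X] and 0 on every other part, so [sigma X] is
    balanced. *)
Lemma sct_sigma E X : supercharacter_theory E -> X \in E.1 ->
  cf_const E.2 (sigma X).
Proof.
move=> sE EX; apply/(sct_balP sE) => Y EY i j Yi Yj; case: sE => pX _ _ _.
have inX k : k \in Y -> ('[sigma X, 'chi_k] / 'chi_k 1%g = (X == Y)%:R)%R.
  move=> Yk; rewrite cfdot_sigma; have [-> | XY] := eqVneq;
    first by rewrite Yk divff ?irr1_neq0.
  case: ifP => [Xk|_]; last by rewrite mul0r.
  by case/eqP: XY; apply: partition_eq_mem pX EX EY Xk Yk.
by rewrite !inX.
Qed.

(** Let [i] lie in the parts [X] of one theory and [Y] of the other. Then [sigma Y] is constant on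
    the common superclasses, hence balanced on [X]; its ratio 1 at [i] forces ratio 1 throughout
    [X], so [X] lies in [Y]. The roles can be exchanged. *)
Lemma sct_eq E E' : supercharacter_theory E -> supercharacter_theory E' ->
  E.2 = E'.2 -> E = E'.
Proof.
move=> sE sE' eq2; rewrite [E]surjective_pairing [E']surjective_pairing eq2.
congr pair; case: (sE) (sE') => pX _ _ _ [pX' _ _ _].
have half (E1 E2 : sct_pair G) X Y i j : supercharacter_theory E1 ->
    supercharacter_theory E2 -> E1.2 = E2.2 ->
    X \in E1.1 -> Y \in E2.1 -> i \in X -> i \in Y -> j \in X -> j \in Y.
  move=> s1 s2 e2 PX PY Xi Yi Xj; have := sct_sigma s2 PY.
  rewrite -e2 => /(sct_balP s1)/(_ X PX i j Xi Xj); rewrite !cfdot_sigma Yi.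
  rewrite divff ?irr1_neq0 //; case: (j \in Y) => //= /eqP.
  by rewrite mul0r oner_eq0.
apply: (partition_eq pX pX') => X Y i j PX PY Xi Yi.
by apply/idP/idP; [apply: (half E E' X Y i j) | apply: (half E' E Y X i j)].
Qed.

End Sigma.

(** * Normal subgroups, quotients and inflation *)

Lemma sct_normal_sub (gT : finGroupType) (G H : {group gT}) (E : sct_pair G) K x :
    partition E.2 G -> sct_normal E H -> K \in E.2 -> x \in K -> x \in H ->
  K \subset H.
Proof.
move=> pK [S sSE defH] EK Kx Hx.
have /bigcupP[L SL Lx] : x \in cover S by rewrite defH.
have EL := subsetP sSE L SL.
by rewrite (partition_eq_mem pK EK EL Kx Lx) -defH (bigcup_max L).
Qed.

Section Quotient.

Variables (gT : finGroupType) (G N : {group gT}).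
Hypothesis nNG : N <| G.

Lemma mod_Iirr_inj : injective (@mod_Iirr gT G N).
Proof. exact: can_inj (mod_IirrK nNG). Qed.

Lemma sigma_mod (B : {set Iirr (G / N)}) :
  sigma [set @mod_Iirr gT G N i | i in B] = (sigma B %% N)%CF.
Proof.
rewrite /sigma (big_imset _ (in2W mod_Iirr_inj)) linear_sum /=.
by apply: eq_bigr => i _; rewrite mod_IirrE // cfMod1 linearZ.
Qed.

Lemma mod_Iirr_setT : [set @mod_Iirr gT G N i | i in [set: Iirr (G / N)]] = Irr_quo G N.
Proof.
apply/setP=> i; rewrite inE; apply/imsetP/idP=> [[j _ ->]|kN].
  by rewrite mod_IirrE ?cfker_mod.
by exists (quo_Iirr N i); rewrite ?inE ?quo_IirrK.
Qed.

Lemma infl_partition (P : {set {set Iirr (G / N)}}) :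
  partition P [set: Iirr (G / N)] -> partition (infl P) (Irr_quo G N).
Proof. by rewrite -mod_Iirr_setT (imset_partition _ _ mod_Iirr_inj). Qed.

Lemma card_infl (P : {set {set Iirr (G / N)}}) : #|infl P| = #|P|.
Proof. by apply: card_imset; apply: imset_inj mod_Iirr_inj. Qed.

(** The parts of [E] inside Irr(G/N) are inflated from a partition of all irreducible characters of
    [G / N], so together they cover Irr(G/N). *)
Lemma sct_quo_sub (E : sct_pair G) (F : sct_pair (G / N)%G) X i :
    partition E.1 [set: Iirr G] -> sct_quo E F -> X \in E.1 -> i \in X ->
  i \in Irr_quo G N -> X \subset Irr_quo G N.
Proof.
move=> pX [_ [pF _ _ _] eqF] EX Xi qi.
have [Y FY Yi] := partition_ex (infl_partition pF) qi.
move: FY; rewrite eqF inE => /andP[EY sY].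
by rewrite (partition_eq_mem pX EX EY Xi Yi).
Qed.

(** Inflation preserves degrees and inner products and sends parts of [F] to parts of [E], so
    balance can be transferred between [G / N] and [G]. *)
Lemma sct_quo_const (E : sct_pair G) (F : sct_pair (G / N)%G) (phi : 'CF(G / N)) :
    supercharacter_theory E -> sct_quo E F ->
  cf_const F.2 phi <-> cf_const E.2 (phi %% N)%CF.
Proof.
move=> sE [_ sF eqF].
have inF B : B \in F.1 -> [set @mod_Iirr gT G N i | i in B] \in E.1.
  move=> FB; have : [set @mod_Iirr gT G N i | i in B] \in infl F.1 by apply: imset_f.
  by rewrite eqF inE => /andP[].
split=> [/(sct_balP sF) | /(sct_balP sE)] bal.
  (* Expanding [phi] in the [sigma X] avoids treating the parts of [E] outside Irr(G/N)
     separately. *)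
  case: sF => pF _ _ _; have [a ->] := cf_bal_sum pF bal.
  have -> : ((\sum_(X in F.1) a X *: sigma X)%R %% N)%CF =
      (\sum_(X in F.1) a X *: (sigma X %% N)%CF)%R.
    by rewrite linear_sum; apply: eq_bigr => X _; rewrite linearZ.
  apply: cf_const_sum => X FX; rewrite -sigma_mod.
  by apply: sct_sigma => //; apply: inF.
apply/(sct_balP sF) => B FB i j Bi Bj.
have := bal _ (inF B FB) (mod_Iirr i) (mod_Iirr j) (imset_f _ Bi) (imset_f _ Bj).
by rewrite !mod_IirrE // !cfMod_iso // !cfMod1.
Qed.

(** The preimage is taken inside the normaliser of [N], which contains [G]. *)
Lemma mem_coset_pre (L : {set coset_of N}) x :
  x \in G -> (x \in coset N @*^-1 L) = (coset N x \in L).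
Proof. by move/(subsetP (normal_norm nNG))=> nNx; apply/morphpreP/idP=> [[]|]. Qed.

Lemma coset_pre_sub (L : {set coset_of N}) :
  L \subset G / N -> coset N @*^-1 L \subset G.
Proof. by rewrite -{2}(quotientGK nNG); apply: morphpreS. Qed.

Lemma coset_pre_cosets (L : {set coset_of N}) :
  L \subset G / N -> union_of_cosets G N (coset N @*^-1 L).
Proof.
move=> sLG; exists [set N :* x | x in coset N @*^-1 L].
  apply/subsetP=> _ /imsetP[x Lx ->]; apply/rcosetsP; exists x => //.
  exact: (subsetP (coset_pre_sub sLG)).
apply/setP=> x; apply/bigcupP/idP=> [[_ /imsetP[y Ly ->] /rcosetP[n Nn ->]]|Lx].
  have Gy := subsetP (coset_pre_sub sLG) y Ly.
  have Gn := subsetP (normal_sub nNG) n Nn.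
  move: Ly; rewrite !mem_coset_pre ?groupM // => Ly.
  by rewrite morphM ?(subsetP (normal_norm nNG)) //= coset_id ?mul1g.
by exists (N :* x); rewrite ?rcoset_refl //; apply: imset_f.
Qed.

Lemma union_of_cosets_mul (K : {set gT}) n x : union_of_cosets G N K ->
  n \in N -> (n * x \in K) = (x \in K).
Proof.
case=> T sTr <- Nn.
have eqA A : A \in T -> (n * x \in A) = (x \in A).
  by move=> /(subsetP sTr)/rcosetsP[y _ ->]; rewrite !mem_rcoset -mulgA groupMl.
by apply/bigcupP/bigcupP=> -[A TA Ax]; exists A; rewrite ?eqA // -eqA.
Qed.

End Quotient.

(** * Clifford theory over the parts of a [G]-invariant theory of [M] *)

Section Induction.

Variables (gT : finGroupType) (G M : {group gT}) (C : sct_pair M).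
Hypotheses (nMG : M <| G) (sctC : supercharacter_theory C).
Hypothesis invC : sct_invariant G C.

Lemma sct_inv_mem K x g : K \in C.2 -> g \in G -> (x ^ g \in K) = (x \in K).
Proof. by move=> CK Gg; rewrite -{1}(invC CK Gg) memJ_conjg. Qed.

(** On [M], invariance keeps [x ^ g] in the superclass of [x]; off [M], both values are 0. *)
Lemma sigma_conj X x g : X \in C.1 -> g \in G -> sigma X (x ^ g) = sigma X x.
Proof.
move=> CX Gg; have [Mx|nMx] := boolP (x \in M); last first.
  by rewrite !cfun0 ?memJ_norm ?(subsetP (normal_norm nMG)).
case: (sctC) => _ pK _ _; have [K CK Kx] := partition_ex pK Mx.
by apply: (sct_sigma sctC CX CK) => //; rewrite sct_inv_mem.
Qed.

(** By Clifford's theorem the constituents of the restriction are conjugate to one in [X], and [X]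
    is stable under conjugation because [sigma X] is. *)
Lemma Irr_over_constt X j k : X \in C.1 -> j \in Irr_over G X ->
  k \in irr_constt ('Res[M] 'chi_j) -> k \in X.
Proof.
move=> CX; rewrite inE => /existsP[i /andP[Xi ji]].
rewrite irr_consttE (Clifford_Res_sum_cfclass nMG ji).
have [/cfclassP[g Gg kE] _ | nk /eqP[]] := boolP ('chi_k \in ('chi_i ^: G)%CF).
  have sE : (sigma X ^ g)%CF = sigma X.
    apply/cfun_inP=> x Mx; rewrite cfConjgE ?(subsetP (normal_norm nMG)) //.
    by rewrite sigma_conj ?groupV.
  (* Conjugation is an isometry fixing [sigma X], so [k] has the same inner product with it as [i],
     and that one is nonzero. *)
  have := cfdot_sigma X k; rewrite kE -{1}sE cfConjg_iso cfdot_sigma Xi -kE.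
  by case: ifP => // _ /eqP; rewrite (negPf (irr1_neq0 i)).
rewrite cfdotZl reindex_cfclass // cfdot_suml big1 ?mulr0 // => l il.
by rewrite cfdot_irr; case: eqP => // lk; rewrite -lk il in nk.
Qed.

(** By Frobenius reciprocity the coefficient at [j] sums degree times multiplicity in the
    restriction of ['chi_j] over the members of [X]. Either [X] contains all constituents of that
    restriction and the sum is its degree, or it contains none and the sum is 0. *)
Lemma Ind_sigma X : X \in C.1 -> ('Ind[G] (sigma X) = sigma (Irr_over G X))%R.
Proof.
move=> CX; rewrite ['Ind[G] _]cfun_sum_cfdot [RHS]cfun_sum_cfdot; apply: eq_bigr => j _.
congr (_ *: _)%R; rewrite cfdot_sigma -Frobenius_reciprocity.
rewrite cfdotC_char ?sigma_char ?cfRes_char ?irr_char //.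
transitivity (\sum_(k in X) 'chi_k 1%g * '['Res[M] 'chi_j, 'chi_k])%R.
  rewrite cfdot_sumr; apply: eq_bigr => k _; rewrite cfdotZr; congr (_ * _)%R.
  by rewrite conj_natr ?Cnat_irr1.
have [Xj|nXj] := ifP; last first.
  apply: big1 => k Xk; apply/eqP; rewrite mulf_eq0; apply/orP; right.
  rewrite -[_ == _]negbK -irr_consttE; apply: contraFN nXj => kj.
  by rewrite inE; apply/existsP; exists k; rewrite Xk.
transitivity ('Res[M] 'chi_j 1%g)%R; last by rewrite cfRes1.
rewrite ['Res[M] 'chi_j]cfun_sum_cfdot sum_cfunE big_mkcond /=; apply: eq_bigr => k _.
rewrite -cfun_sum_cfdot cfunE mulrC; case: ifP => // Xk.
have [/(Irr_over_constt CX Xj)|] := boolP (k \in irr_constt ('Res[M] 'chi_j));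
  first by rewrite Xk.
by rewrite irr_consttE negbK => /eqP->; rewrite mul0r.
Qed.

(** All [#|G|] terms of the formula for an induced value are equal, by [sigma_conj]. *)
Lemma Ind_sigmaE X x : X \in C.1 -> x \in M ->
  ('Ind[G] (sigma X) x = #|G : M|%:R * sigma X x)%R.
Proof.
move=> CX Mx; rewrite cfIndE ?normal_sub //.
rewrite (eq_bigr (fun=> sigma X x)) => [|y Gy]; last exact: sigma_conj.
rewrite sumr_const -[(_ *+ #|G|)%R]mulr_natl mulrA; congr (_ * _)%R.
by rewrite natf_indexg ?normal_sub // mulrC.
Qed.

Lemma Irr_over_neq0 X : X \in C.1 -> Irr_over G X != set0.
Proof.
case: (sctC) => pX _ _ _ CX; have /set0Pn[i Xi] := partition_neq0 pX CX.
have [j] := neq0_has_constt (Ind_irr_neq0 i (normal_sub nMG)).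
rewrite constt_Ind_Res => ij; apply/set0Pn; exists j; rewrite inE.
by apply/existsP; exists i; rewrite Xi.
Qed.

Lemma Irr_over_ex j : exists2 X, X \in C.1 & j \in Irr_over G X.
Proof.
have [i ij] := constt_cfRes_irr M j.
case: (sctC) => pX _ _ _; have [X CX Xi] := partition_ex pX (in_setT i).
by exists X; rewrite // inE; apply/existsP; exists i; rewrite Xi.
Qed.

Lemma Irr_over_eq X Y j : X \in C.1 -> Y \in C.1 ->
  j \in Irr_over G X -> j \in Irr_over G Y -> X = Y.
Proof.
move=> CX CY Xj Yj; case: (sctC) => pX _ _ _.
have : j \in Irr_over G X by [].
rewrite inE => /existsP[i /andP[Xi ij]].
exact: partition_eq_mem pX CX CY Xi (Irr_over_constt CY Yj ij).
Qed.

(** [N] lies in the kernel of ['chi_j] iff it lies in the kernel of every constituent of the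
    restriction to [M]. These constituents are all in [X], and [X] is inside Irr(M/N) as soon as it
    meets it. *)
Lemma Irr_over_quo (N : {group gT}) (F : sct_pair (M / N)%G) X j :
    N <| M -> sct_quo C F -> X \in C.1 -> j \in Irr_over G X ->
  (j \in Irr_quo G N) = (X \subset Irr_quo M N).
Proof.
move=> nNM qF CX Xj; have sNM := normal_sub nNM.
case: (sctC) => pX _ _ _; have chR := cfRes_char M (irr_char j).
have kerR : (j \in Irr_quo G N) = (N \subset cfker ('Res[M] 'chi_j)%R).
  by rewrite inE cfker_Res ?(normal_sub nMG) ?irr_char // subsetI sNM.
rewrite kerR; apply/idP/idP=> [kj | sX].
  have : j \in Irr_over G X by [].
  rewrite inE => /existsP[i /andP[Xi ij]].
  apply: (sct_quo_sub nNM pX qF CX Xi); rewrite inE.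
  exact: subset_trans kj (cfker_constt chR ij).
rewrite cfkerE // subsetI sNM; apply/bigcapsP=> k kj.
by have := subsetP sX k (Irr_over_constt CX Xj kj); rewrite inE.
Qed.

End Induction.

(** * The product of [C] and [D], where [F] is the common theory of condition 3 *)

Section Product.

Variables (gT : finGroupType) (G M N : {group gT}).
Hypotheses (nNG : N <| G) (nMG : M <| G) (sNM : N \subset M).
Variables (C : sct_pair M) (D : sct_pair (G / N)%G) (F : sct_pair (M / N)%G).
Hypotheses (sctC : supercharacter_theory C) (invC : sct_invariant G C).
Hypotheses (sctD : supercharacter_theory D).
Hypotheses (qCF : sct_quo C F) (sDF : sct_sub D F).

Let sMG : M \subset G := normal_sub nMG.
Let nNM : N <| M := normalS sNM sMG nNG.
Let pC2 : partition C.2 M. Proof. by case: sctC. Qed.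
Let pD1 : partition D.1 [set: Iirr (G / N)]. Proof. by case: sctD. Qed.
Let pD2 : partition D.2 (G / N). Proof. by case: sctD. Qed.

Lemma mem_coset_quo x : x \in G -> (coset N x \in M / N) = (x \in M).
Proof. by move=> Gx; rewrite -(mem_coset_pre nNG) // quotientGK. Qed.

(** [M / N] is a union of superclasses of [D], so a single point of [L] decides whether [L] lies
    inside. *)
Lemma sct_sub_coset L x : L \in D.2 -> x \in G -> coset N x \in L ->
  (L \subset M / N) = (x \in M).
Proof.
move=> DL Gx Lx; rewrite -mem_coset_quo //; apply/idP/idP=> [/subsetP->//|].
by case: sDF => nMN _ _; apply: sct_normal_sub pD2 nMN DL Lx.
Qed.

Lemma sct_product1P X : X \in (sct_product C D).1 ->
  (exists2 B, B \in D.1 & X = [set @mod_Iirr gT G N i | i in B]) \/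
  (exists Z, [/\ Z \in C.1, ~~ (Z \subset Irr_quo M N) & X = Irr_over G Z]).
Proof.
rewrite inE => /orP[/imsetP[B DB ->]|/imsetP[Z]]; first by left; exists B.
by rewrite inE => /andP[CZ nZ] ->; right; exists Z.
Qed.

Lemma sct_product2P K : K \in (sct_product C D).2 ->
  K \in C.2 \/
  (exists L, [/\ L \in D.2, ~~ (L \subset M / N) & K = coset N @*^-1 L]).
Proof.
rewrite inE => /orP[CK|/imsetP[L]]; first by left.
by rewrite inE => /andP[DL nL] ->; right; exists L.
Qed.

Lemma mem_sct_product2l K : K \in C.2 -> K \in (sct_product C D).2.
Proof. by rewrite inE => ->. Qed.

Lemma mem_sct_product2r L : L \in D.2 -> ~~ (L \subset M / N) ->
  coset N @*^-1 L \in (sct_product C D).2.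
Proof. by move=> DL nL; rewrite inE imset_f ?orbT // inE DL. Qed.

Lemma mem_sct_product1l B : B \in D.1 ->
  [set @mod_Iirr gT G N i | i in B] \in (sct_product C D).1.
Proof. by move=> DB; rewrite inE imset_f. Qed.

Lemma mem_sct_product1r Z : Z \in C.1 -> ~~ (Z \subset Irr_quo M N) ->
  Irr_over G Z \in (sct_product C D).1.
Proof. by move=> CZ nZ; rewrite inE imset_f ?orbT // inE CZ. Qed.

Lemma mem_coset_pre_notin L x : L \in D.2 -> ~~ (L \subset M / N) ->
  x \in coset N @*^-1 L -> x \notin M.
Proof.
move=> DL nL Lx; have sL := partitionS pD2 DL.
have Gx := subsetP (coset_pre_sub nNG sL) x Lx.
by rewrite -(sct_sub_coset DL Gx) // -(mem_coset_pre nNG).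
Qed.

Lemma coset_pre_eq L L' x : L \in D.2 -> L' \in D.2 ->
  x \in coset N @*^-1 L -> x \in coset N @*^-1 L' -> L = L'.
Proof.
move=> DL DL' Lx L'x.
have Gx := subsetP (coset_pre_sub nNG (partitionS pD2 DL)) x Lx.
apply: (@partition_eq_mem _ _ _ _ _ (coset N x) pD2 DL DL').
  by rewrite -(mem_coset_pre nNG).
by rewrite -(mem_coset_pre nNG).
Qed.

Lemma coset_pre_neq0 L : L \in D.2 -> coset N @*^-1 L != set0.
Proof.
move=> DL; have /set0Pn[y Ly] := partition_neq0 pD2 DL.
have /morphimP[x Nx Gx ye] := partition_in pD2 DL Ly.
by apply/set0Pn; exists x; rewrite (mem_coset_pre nNG) // -ye.
Qed.

(** The superclasses of [C] cover [M], and the preimages of superclasses of [D] outside [M / N]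
    cover exactly the rest of [G]. *)
Lemma sct_product_partition2 : partition (sct_product C D).2 G.
Proof.
apply: partition_intro => [K|K|x Gx|K K' x].
- by case/sct_product2P=> [/(partition_neq0 pC2)//|[L [DL _ ->]]]; apply: coset_pre_neq0.
- case/sct_product2P=> [/(partitionS pC2)sKM|[L [DL _ ->]]].
    exact: subset_trans sKM sMG.
  exact: coset_pre_sub (partitionS pD2 DL).
- have [Mx|nMx] := boolP (x \in M).
    have [K CK Kx] := partition_ex pC2 Mx.
    by exists K => //; apply: mem_sct_product2l.
  have [L DL Lx] := partition_ex pD2 (mem_quotient N Gx).
  exists (coset N @*^-1 L); last by rewrite (mem_coset_pre nNG).
  by apply: mem_sct_product2r; rewrite // (sct_sub_coset DL Gx).
have off A L : A \in C.2 -> L \in D.2 -> ~~ (L \subset M / N) ->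
    x \in A -> x \in coset N @*^-1 L -> False.
  move=> CA DL nL Ax Lx; have := mem_coset_pre_notin DL nL Lx.
  by rewrite (partition_in pC2 CA Ax).
case/sct_product2P=> [CK|[L [DL nL ->]]] /sct_product2P[CK'|[L' [DL' nL' ->]]].
- exact: partition_eq_mem pC2 CK CK'.
- by move=> Kx Lx; case: (off K L').
- by move=> Lx Kx; case: (off K' L).
- by move=> Lx L'x; rewrite (coset_pre_eq DL DL' Lx L'x).
Qed.

(** The inflated parts cover Irr(G/N); by [Irr_over_quo], the remaining sets [Irr_over G Z] cover
    exactly its complement. *)
Lemma sct_product_partition1 : partition (sct_product C D).1 [set: Iirr G].
Proof.
have pI := infl_partition nNG pD1.
apply: partition_intro => [X|X _|j _|X X' j].
- case/sct_product1P=> [[B DB ->]|[Z [CZ _ ->]]]; last exact: (Irr_over_neq0 nMG sctC CZ).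
  by apply: partition_neq0 pI _; apply: imset_f.
- exact: subsetT.
- have [qj|nqj] := boolP (j \in Irr_quo G N).
    have [X /imsetP[B DB ->] Xj] := partition_ex pI qj.
    by eexists; [apply: (mem_sct_product1l DB) | ].
  have [Z CZ Zj] := Irr_over_ex sctC j.
  exists (Irr_over G Z) => //; apply: mem_sct_product1r => //.
  by rewrite -(Irr_over_quo nMG sctC invC nNM qCF CZ Zj).
have off B Z : B \in D.1 -> Z \in C.1 -> ~~ (Z \subset Irr_quo M N) ->
    j \in [set @mod_Iirr gT G N i | i in B] -> j \in Irr_over G Z -> False.
  move=> DB CZ nZ Bj Zj; case/negP: nZ.
  rewrite -(Irr_over_quo nMG sctC invC nNM qCF CZ Zj).
  by apply: (partition_in pI _ Bj); apply: imset_f.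
case/sct_product1P=> [[B DB ->]|[Z [CZ nZ ->]]]
  /sct_product1P[[B' DB' ->]|[Z' [CZ' nZ' ->]]].
- by apply: (partition_eq_mem pI); apply: imset_f.
- by move=> Bj Zj; case: (off B Z').
- by move=> Zj Bj; case: (off B' Z).
- by move=> Zj Zj'; rewrite (Irr_over_eq nMG sctC invC CZ CZ' Zj Zj').
Qed.

(** [F] links the two counts: the parts of [C] inside Irr(M/N) number [#|F.1|], which equals
    [#|F.2|], the number of superclasses of [D] inside [M / N]. *)
Lemma sct_product_card : #|(sct_product C D).1| = #|(sct_product C D).2|.
Proof.
case: qCF => _ [_ _ eqF _] defF1; case: sDF => _ _ defF2.
case: (sctC) (sctD) => _ _ eqC _ [_ _ eqD _].
have pI := infl_partition nNG pD1.
have -> : #|(sct_product C D).1| =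
    (#|D.1| + #|[set X in C.1 | ~~ (X \subset Irr_quo M N)]|)%N.
  rewrite cardsU disjoint_setI0 ?cards0 ?subn0 ?card_infl //; last first.
    rewrite -setI_eq0; apply/eqP/setP=> X; rewrite !inE;
      apply/negP=> /andP[IX /imsetP[Z]].
    rewrite inE => /andP[CZ nZ] eX; have /set0Pn[j Zj] := Irr_over_neq0 nMG sctC CZ.
    case/negP: nZ; rewrite -(Irr_over_quo nMG sctC invC nNM qCF CZ Zj).
    by apply: partition_in pI IX _; rewrite eX.
  rewrite card_in_imset // => Z Z'; rewrite !inE => /andP[CZ _] /andP[CZ' _] eZ.
  have /set0Pn[j Zj] := Irr_over_neq0 nMG sctC CZ.
  by apply: (Irr_over_eq nMG sctC invC CZ CZ' Zj); rewrite -eZ.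
have -> : #|(sct_product C D).2| =
    (#|C.2| + #|[set L in D.2 | ~~ (L \subset M / N)]|)%N.
  rewrite cardsU disjoint_setI0 ?cards0 ?subn0 //; last first.
    rewrite -setI_eq0; apply/eqP/setP=> K; rewrite !inE;
      apply/negP=> /andP[CK /imsetP[L]].
    rewrite inE => /andP[DL nL] eK; have /set0Pn[x Kx] := partition_neq0 pC2 CK.
    have := mem_coset_pre_notin DL nL (x := x).
    by rewrite -eK Kx (partition_in pC2 CK Kx) => /(_ isT).
  rewrite card_in_imset // => L L'; rewrite !inE => /andP[DL _] /andP[DL' _] eL.
  have /set0Pn[x Lx] := coset_pre_neq0 DL.
  by apply: (coset_pre_eq DL DL' Lx); rewrite -eL.
have splitE (T : finType) (P : {set {set T}}) (A : {set T}) :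
    #|P| = (#|[set X in P | X \subset A]| + #|[set X in P | ~~ (X \subset A)]|)%N.
  rewrite -(cardsID [set X : {set T} | X \subset A] P); congr (_ + _)%N.
    by apply: eq_card => X; rewrite !inE.
  by apply: eq_card => X; rewrite !inE andbC.
have := splitE _ C.1 (Irr_quo M N); rewrite -defF1 card_infl // eqF defF2 => cC.
have cD := splitE _ D.2 (M / N).
by rewrite eqD cD -eqC cC addnC addnCA addnA.
Qed.

Lemma sct_product_sct : supercharacter_theory (sct_product C D).
Proof.
apply: sct_intro; [exact: sct_product_partition1 | exact: sct_product_partition2 |
  exact: sct_product_card | move=> X /sct_product1P[[B DB ->]|[Z [CZ _ ->]]]].
  rewrite (sigma_mod nNG) => K /sct_product2P[CK|[L [DL _ ->]]] x y Kx Ky.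
    have [Mx My] := (partition_in pC2 CK Kx, partition_in pC2 CK Ky).
    have sMGN : M / N \subset G / N by apply: quotientS.
    (* Superclasses of [F] are superclasses of [D], so restriction keeps constancy; [sct_quo_const]
       for [C] then lifts it to [M]. *)
    have cF : cf_const F.2 ('Res[M / N] (sigma B))%R.
      case: sDF => _ [_ pF _ _] defF L FL u v Lu Lv.
      rewrite !cfResE ?(partition_in pF FL) //.
      by apply: (sct_sigma sctD DB) Lu Lv; move: FL; rewrite defF inE => /andP[].
    have := (sct_quo_const nNM _ sctC qCF).1 cF K CK x y Kx Ky.
    by rewrite !cfModE ?(subsetP sMG) // !cfResE ?mem_quotient.
  have Gx := subsetP (coset_pre_sub nNG (partitionS pD2 DL)) x Kx.
  have Gy := subsetP (coset_pre_sub nNG (partitionS pD2 DL)) y Ky.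
  rewrite !cfModE //; apply: (sct_sigma sctD DB DL); by rewrite -(mem_coset_pre nNG).
rewrite -(Ind_sigma nMG sctC invC CZ) => K /sct_product2P[CK|[L [DL nL ->]]] x y Kx Ky.
  rewrite !(Ind_sigmaE nMG sctC invC) ?(partition_in pC2 CK) //.
  by rewrite (sct_sigma sctC CZ CK Kx Ky).
rewrite !(cfun_on0 (cfInd_normal _ nMG)) //; exact: (mem_coset_pre_notin DL nL).
Qed.

Lemma sct_product_sub : sct_sub (sct_product C D) C.
Proof.
split=> //.
  by exists C.2; [apply: subsetUl | apply: cover_partition pC2].
apply/setP=> K; rewrite inE; apply/idP/andP=> [CK|[]].
  by rewrite mem_sct_product2l // (partitionS pC2).
case/sct_product2P=> // -[L [DL nL ->]] sLM.
have /set0Pn[x Lx] := coset_pre_neq0 DL.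
by have := mem_coset_pre_notin DL nL Lx; rewrite (subsetP sLM).
Qed.

(** [N] is covered by superclasses of [C], which the product keeps. When [Z] is not inside Irr(M/N),
    [Irr_over G Z] contains no character of Irr(G/N), so only inflated parts remain there. *)
Lemma sct_product_quo : sct_quo (sct_product C D) D.
Proof.
have pI := infl_partition nNG pD1; split=> //.
  case: qCF => [[S sSC covS] _ _]; exists S => //.
  exact: subset_trans sSC (subsetUl _ _).
apply/setP=> X; rewrite inE; apply/idP/andP=> [IX|[]].
  by rewrite inE IX (partitionS pI).
case/sct_product1P=> [[B DB -> _]|[Z [CZ nZ ->]] sZ]; first exact: imset_f.
have /set0Pn[j Zj] := Irr_over_neq0 nMG sctC CZ; case/negP: nZ.
by rewrite -(Irr_over_quo nMG sctC invC nNM qCF CZ Zj) (subsetP sZ).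
Qed.

Lemma sct_product_cosets K : K \in (sct_product C D).2 -> [disjoint K & M] ->
  union_of_cosets G N K.
Proof.
case/sct_product2P=> [CK dKM|[L [DL _ ->]] _]; last first.
  exact: coset_pre_cosets (partitionS pD2 DL).
have /set0Pn[x Kx] := partition_neq0 pC2 CK.
by have := disjointFr dKM Kx; rewrite (partition_in pC2 CK Kx).
Qed.

(* Off [M], a superclass A of E is a union of N-cosets, so its indicator is
   inflated from G/N and is constant on the superclasses of D by
   [sct_quo_const]; conversely the indicator of a superclass of D inflates to
   a function constant on A. *)
Lemma sct_product_unique (E : sct_pair G) :
    supercharacter_theory E -> sct_sub E C -> sct_quo E D ->
    (forall K : {set gT}, K \in E.2 -> [disjoint K & M] -> union_of_cosets G N K) ->
  sct_product C D = E.
Proof.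
move=> sE [nME _ defC] qED cosE; have pE : partition E.2 G by case: sE.
apply/esym/(sct_eq sE sct_product_sct).
apply: (partition_eq pE sct_product_partition2) => A K x y EA PK Ax Kx.
(* Inside [M], the superclass [A] of [E] belongs to [C], hence to the product. *)
have [Mx|nMx] := boolP (x \in M).
  have CA : A \in C.2 by rewrite defC inE EA (sct_normal_sub pE nME EA Ax Mx).
  have PA := mem_sct_product2l CA.
  by rewrite (partition_eq_mem sct_product_partition2 PA PK Ax Kx).
have [CK|[L [DL nL eK]]] := sct_product2P PK.
  by rewrite (partition_in pC2 CK Kx) in nMx.
have dAM : [disjoint A & M].
  rewrite disjoint_subset; apply/subsetP=> z Az; rewrite inE; apply: contra nMx => Mz.
  exact: (subsetP (sct_normal_sub pE nME EA Az Mz)).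
have uA := cosE A EA dAM.
have Gx := partition_in pE EA Ax.
(* The indicator of a block is constant on all blocks; stated for any group because it serves both
   in [G] and in [G / N]. *)
have part_ind (hT : finGroupType) (H : {group hT}) (P : {set {set hT}}) (B : {set hT}) :
    partition P H -> B \in P -> forall R, R \in P ->
    {in R &, forall u v, (u \in B)%:R = (v \in B)%:R :> algC}%R.
  move=> pP PB R PR u v Ru Rv; have [Bu|nBu] := boolP (u \in B).
    by rewrite -(partition_eq_mem pP PR PB Ru Bu) Rv.
  case: (boolP (v \in B)) => // Bv.
  by rewrite -(partition_eq_mem pP PR PB Rv Bv) Ru in nBu.
apply/idP/idP=> [Ay|Ky].
  have [psi psiE] := cf_const_class_fun sctD (part_ind _ _ _ _ pD2 DL).
  have Gy := partition_in pE EA Ay.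
  have cpsi : cf_const D.2 psi.
    move=> R DR u v Ru Rv; rewrite !psiE ?(partition_in pD2 DR) //.
    exact: (part_ind _ _ _ _ pD2 DL R).
  have := (sct_quo_const nNG psi sE qED).1 cpsi A EA x y Ax Ay.
  rewrite !cfModE // !psiE ?mem_quotient // -!(mem_coset_pre nNG) // -eK Kx.
  by case: (y \in K) => // /eqP; rewrite oner_eq0.
have [phi phiE] := cf_const_class_fun sE (part_ind _ _ _ _ pE EA).
have Gy := partition_in sct_product_partition2 PK Ky.
(* Left translation by [N] preserves [A], so its indicator [phi] is inflated from [G / N]. *)
have kerN : N \subset cfker phi.
  apply/subsetP=> n Nn; have Gn := subsetP (normal_sub nNG) n Nn.
  rewrite inE Gn; apply/forallP=> z; have [Gz|nGz] := boolP (z \in G).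
    by rewrite !phiE ?groupM // (union_of_cosets_mul _ uA Nn).
  by rewrite !cfun0 ?groupMl.
have cphi : cf_const E.2 (phi / N %% N)%CF.
  rewrite cfQuoK // => R ER u v Ru Rv; rewrite !phiE ?(partition_in pE ER) //.
  exact: (part_ind _ _ _ _ pE EA R).
have := (sct_quo_const nNG _ sE qED).2 cphi L DL (coset N x) (coset N y).
rewrite -!(mem_coset_pre nNG) // -eK Kx Ky => /(_ isT isT).
rewrite -!(cfModE _ nNG) // cfQuoK // !phiE // Ax.
by case: (y \in A) => // /eqP; rewrite oner_eq0.
Qed.

End Product.

(** * Existence, uniqueness and explicit form of the product theory *)

Theorem theorem9p1 (gT : finGroupType) (G M N : {group gT})
    (nNG : N <| G) (nMG : M <| G) (sNM : N \subset M)
    (C : sct_pair M) (D : sct_pair (G / N)%G)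
    (sctC : supercharacter_theory C) (invC : sct_invariant G C)
    (sctD : supercharacter_theory D)
    (nN : sct_normal C N)
    (nMN : sct_normal D (M / N)%G)
    (eqCD : exists F : sct_pair (M / N)%G, sct_quo C F /\ sct_sub D F) :
  exists E : sct_pair G,
    unique (fun E' : sct_pair G =>
      [/\ supercharacter_theory E',
          sct_sub E' C,
          sct_quo E' D
        & forall K : {set gT}, K \in E'.2 -> [disjoint K & M] ->
            union_of_cosets G N K]) E
    /\ E = sct_product C D.
Proof.
case: eqCD => F [qCF sDF]; exists (sct_product C D); split=> //; split.
  split; [exact: sct_product_sct qCF sDF | exact: sct_product_sub sDF |
    exact: sct_product_quo qCF | by move=> K; apply: sct_product_cosets].
by move=> E' [sE sub quo cos]; apply: (sct_product_unique _ _ _ _ _ _ qCF sDF).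
Qed.
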